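(* Let $n\ge 2$. The loopless quantum graphs on $M_n$ acted on by the orthogonal group $O(n)$ are precisely the following four: the edgeless quantum graph $K_n^c$, the complete quantum graph $K_n$, the antisymmetric quantum graph $G^{\mathrm{asym}}$, and the symmetric quantum graph $G^{\mathrm{sym}}$.
   Context: $M_n=M_n(\mathbb C)$, with matrix units $E_{ij}$. A quantum graph on $M_n$ is a linear map $G\colon M_n\to M_n$ (its adjacency operator) satisfying $\sum_{k} G(E_{ik})G(E_{kj})=G(E_{ij})$ for all $i,j$ (Schur idempotency, in the unnormalised convention) and $G(x^\dagger)=G(x)^\dagger$ for all $x$ (realness). It is loopless if $\sum_k G(E_{ik})E_{kj}=0$ for all $i,j$. A group $X\subseteq U(n)$ acts on $G$ if $G(uxu^\dagger)=u\,G(x)\,u^\dagger$ for all $u\in X$, $x\in M_n$. Here $O(n)\subseteq U(n)$ is the group of real orthogonal matrices. Adjacency operators: $K_n^c=0$; $K_n(x)=\mathrm{Tr}(x)I-\tfrac1n x$; $G^{\mathrm{asym}}(x)=\tfrac12(\mathrm{Tr}(x)I-x^{T})$, whose associated operator space is the space of antisymmetric matrices; $G^{\mathrm{sym}}(x)=\tfrac12(\mathrm{Tr}(x)I+x^{T})-\tfrac1n x$, whose associated operator space is the space of traceless symmetric matrices. *)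

(* Defs.v *)
From HB Require Import structures.
From mathcomp Require Import all_boot all_order all_algebra.
From mathcomp Require Import complex.
From mathcomp Require Import boolp classical_sets functions cardinality reals.
Set Implicit Arguments.
Unset Strict Implicit.
Unset Printing Implicit Defensive.
Import Order.TTheory GRing.Theory Num.Theory.
Local Open Scope ring_scope.
Local Open Scope sesquilinear_scope.

Section QuantumGraphs.
Variables (R : realType) (n : nat).
Local Notation C := R[i].
Local Notation M := 'M[C]_n.

(* Unnormalised convention: no factor 1/n in front of the sum. *)
Definition schur_idempotent (G : M -> M) : Prop :=
  forall i j : 'I_n,
    \sum_k G (delta_mx i k) *m G (delta_mx k j) = G (delta_mx i j).

Definition real_map (G : M -> M) : Prop := forall x : M, G (x ^t*) = (G x) ^t*.

(* A quantum graph is identified with its adjacency operator. *)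
Record quantum_graph (G : M -> M) : Prop := QuantumGraph {
  qg_linear : linear G;
  qg_schur : schur_idempotent G;
  qg_real : real_map G }.

Definition loopless (G : M -> M) : Prop :=
  forall i j : 'I_n, \sum_k G (delta_mx i k) *m delta_mx k j = 0.

Record unitary_subgroup (X : set M) : Prop := UnitarySubgroup {
  usg_unitary : forall u, X u -> u \is unitarymx;
  usg_one : X 1%:M;
  usg_mul : forall u v, X u -> X v -> X (u *m v);
  usg_inv : forall u, X u -> X (u ^t*) }.

Definition acts_on (X : set M) (G : M -> M) : Prop :=
  forall u, X u -> forall x : M, G (u *m x *m u ^t*) = u *m G x *m u ^t*.

Definition orthogonal_group : set M :=
  [set u | u \is a mxOver Num.real /\ u *m u^T = 1%:M]%classic.

Lemma trmxC_real (u : M) : u \is a mxOver Num.real -> u ^t* = u^T.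
Proof.
move=> /mxOverP uR; apply/matrixP => i j; rewrite !mxE.
exact/CrealP/uR.
Qed.

Lemma orthogonal_group_subgroup : unitary_subgroup orthogonal_group.
Proof.
split=> [u [uR uO]||u v [uR uO] [vR vO]|u [uR uO]].
- by apply/unitarymxP; rewrite trmxC_real.
- split; last by rewrite trmx1 mulmx1.
  by apply/mxOverP => i j; rewrite !mxE realn.
- split; first exact: mxOverM.
  by rewrite trmx_mul mulmxA -(mulmxA u) vO mulmx1.
- rewrite trmxC_real //; split; last by rewrite trmxK; apply: mulmx1C.
  by apply/mxOverP => i j; rewrite mxE; apply: (mxOverP uR).
Qed.

Definition edgeless_graph (x : M) : M := 0.

Definition complete_graph (x : M) : M := (\tr x)%:M - n%:R^-1 *: x.

Definition antisymmetric_graph (x : M) : M := 2^-1 *: ((\tr x)%:M - x^T).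

Definition symmetric_graph (x : M) : M :=
  2^-1 *: ((\tr x)%:M + x^T) - n%:R^-1 *: x.

End QuantumGraphs.

Arguments orthogonal_group : clear implicits.
Arguments edgeless_graph : clear implicits.
Arguments complete_graph : clear implicits.
Arguments antisymmetric_graph : clear implicits.
Arguments symmetric_graph : clear implicits.

(* Main.v *)
From HB Require Import structures.
Require Import Defs.
From mathcomp Require Import all_boot all_order all_algebra.
From mathcomp Require Import complex perm ring.
From mathcomp Require Import boolp classical_sets functions cardinality reals.
(** Conjugating by diagonal signs, permutations and one planar reflection shows
    that an O(n)-equivariant linear map is x |-> a tr(x) I + b x + c x^T.
    Schur idempotency then reads a^2 + c^2 = a, 2ab + n b^2 + 2bc = b, 2ac = c
    and looplessness reads a + n b + c = 0.  As 2ac = c forces c = 0 or a = 1/2,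
    this system has exactly four solutions. *)

Import GRing.Theory Num.Theory.
Local Open Scope ring_scope.
Local Open Scope classical_set_scope.
Local Open Scope card_scope.
Local Open Scope sesquilinear_scope.

(** * Algebra of the maps spanned by the trace, identity and transpose *)

Section TraceTransposeMaps.
Variables (F : numFieldType) (n : nat).
Implicit Types (a b c : F) (x : 'M[F]_n).

(** The coefficients form a single triple, so that injectivity in them and membership in a finite
    list of solutions can be stated directly. *)
Definition ttmap (p : F * F * F) x : 'M[F]_n :=
  p.1.1 *: (\tr x)%:M + p.1.2 *: x + p.2 *: x^T.

Lemma mxtrace_delta (i j : 'I_n) : \tr (delta_mx i j : 'M[F]_n) = (i == j)%:R.
Proof.
rewrite /mxtrace (bigD1 i) //= big1 ?addr0 => [|k /negPf ki].
  by rewrite mxE eqxx.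
by rewrite mxE ki.
Qed.

Lemma ttmap_delta p (i j : 'I_n) :
  ttmap p (delta_mx i j) =
  (p.1.1 *+ (i == j))%:M + p.1.2 *: delta_mx i j + p.2 *: delta_mx j i.
Proof. by rewrite /ttmap mxtrace_delta trmx_delta scale_scalar_mx mulr_natr. Qed.

Lemma ttmap_linear p : linear (ttmap p).
Proof.
move=> k x y; rewrite /ttmap linearP linearP /=.
apply/matrixP => i j; rewrite !mxE.
by case: (i == j); rewrite ?mulr0n ?mulr1n; ring.
Qed.

Lemma eq_linear_delta (f g : 'M[F]_n -> 'M[F]_n) : linear f -> linear g ->
  (forall i j, f (delta_mx i j) = g (delta_mx i j)) -> f =1 g.
Proof.
move=> fl gl fg x.
pose fL : {linear _ -> _} := HB.pack f (GRing.isLinear.Build _ _ _ _ f fl).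
pose gL : {linear _ -> _} := HB.pack g (GRing.isLinear.Build _ _ _ _ g gl).
rewrite (matrix_sum_delta x) -[f _]/(fL _) -[g _]/(gL _) !linear_sum.
apply: eq_bigr => i _; rewrite !linear_sum; apply: eq_bigr => j _.
by rewrite !linearZ /= fg.
Qed.

Lemma sum_delta_l (i : 'I_n) (A : 'I_n -> 'M[F]_n) (a : F) :
  \sum_k (a *+ (i == k))%:M *m A k = a *: A i.
Proof.
rewrite (bigD1 i) //= big1 ?addr0 => [|k /negPf ki].
  by rewrite eqxx mul_scalar_mx.
by rewrite eq_sym ki mulr0n mul_scalar_mx scale0r.
Qed.

Lemma sum_delta_r (j : 'I_n) (A : 'I_n -> 'M[F]_n) (a : F) :
  \sum_k A k *m (a *+ (k == j))%:M = a *: A j.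
Proof.
rewrite (bigD1 j) //= big1 ?addr0 => [|k /negPf kj].
  by rewrite eqxx mul_mx_scalar.
by rewrite kj mulr0n mul_mx_scalar scale0r.
Qed.

Lemma ttmap_sum_l p (i j : 'I_n) :
  \sum_k delta_mx i k *m ttmap p (delta_mx k j) =
  (p.1.1 + n%:R * p.1.2 + p.2) *: delta_mx i j.
Proof.
under eq_bigr do rewrite ttmap_delta !mulmxDr -!scalemxAr mul_delta_mx.
rewrite !big_split /= sum_delta_r sumr_const card_ord -scaler_sumr.
rewrite (bigD1 j) //= big1 ?addr0 => [|k /negPf kj]; last first.
  by rewrite mul_delta_mx_0 ?kj.
by rewrite mul_delta_mx -scaler_nat !scalerA -!scalerDl mulrC.
Qed.

(** The outer coefficients trade places: multiplying by E_ki on the left and summing turns the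
    scalar term into a E_ji, while E_ki E_jk vanishes unless i = j and then sums to the identity. *)
Lemma ttmap_sum_r p (i j : 'I_n) :
  \sum_k delta_mx k i *m ttmap p (delta_mx k j) =
  ttmap (p.2, p.1.2, p.1.1) (delta_mx i j).
Proof.
under eq_bigr do rewrite ttmap_delta !mulmxDr -!scalemxAr
  (mul_delta_mx_cond _ i j).
rewrite ttmap_delta !big_split /= sum_delta_r -2!scaler_sumr.
rewrite (bigD1 i) //= big1 ?addr0 => [|k /negPf ki]; last first.
  by rewrite mul_delta_mx_0 // eq_sym ki.
rewrite mul_delta_mx sumrMnl -mx1_sum_delta -scalerMnr scalerMnl.
rewrite scale_scalar_mx mulr1.
by rewrite addrC addrA addrAC.
Qed.

(** Only the left factor is expanded: its scalar part returns a times the map itself, its [b] part a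
    multiple of E_ij by [ttmap_sum_l], and its [c] part the map with [a] and [c] exchanged by
    [ttmap_sum_r]. *)
Lemma ttmap_schur a b c (i j : 'I_n) :
  \sum_k ttmap (a, b, c) (delta_mx i k) *m ttmap (a, b, c) (delta_mx k j) =
  ttmap (a ^+ 2 + c ^+ 2, 2 * a * b + n%:R * b ^+ 2 + 2 * b * c, 2 * a * c)
        (delta_mx i j).
Proof.
under eq_bigr do rewrite (ttmap_delta _ i) /= 2!mulmxDl -2!scalemxAl.
rewrite !big_split /= sum_delta_l -2!scaler_sumr ttmap_sum_l ttmap_sum_r.
apply/matrixP => k l; rewrite !ttmap_delta !mxE /=.
case: (i == j); case: (k == l); rewrite ?mulr0n ?mulr1n; ring.
Qed.

Lemma ttmap_loop a b c (i j : 'I_n) :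
  \sum_k ttmap (a, b, c) (delta_mx i k) *m delta_mx k j =
  (a + n%:R * b + c) *: delta_mx i j.
Proof.
under eq_bigr do rewrite ttmap_delta !mulmxDl -!scalemxAl mul_delta_mx /=.
rewrite !big_split /= sum_delta_l sumr_const card_ord -scaler_sumr.
rewrite (bigD1 i) //= big1 ?addr0 => [|k /negPf ki]; last first.
  by rewrite mul_delta_mx_0 // eq_sym ki.
by rewrite mul_delta_mx -scaler_nat !scalerA -!scalerDl mulrC.
Qed.

(** Two distinct indices isolate each coefficient in one entry: [a] in the image of E_00, [b] and
    [c] in that of E_01. In size one the three basic maps coincide. *)
Lemma ttmap_inj : (1 < n)%N -> injective ttmap.
Proof.
move=> n1 [[a b] c] [[a' b'] c'] pq.
pose o0 := Ordinal (ltnW n1); pose o1 := Ordinal n1.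
have E i j k l : ttmap (a, b, c) (delta_mx i j) k l =
  ttmap (a', b', c') (delta_mx i j) k l by rewrite pq.
move: (E o0 o0 o1 o1) (E o0 o1 o0 o1) (E o0 o1 o1 o0).
rewrite !ttmap_delta !mxE /= !(mulr0, mulr1, mulr0n, mulr1n, addr0, add0r).
by move=> -> -> ->.
Qed.

End TraceTransposeMaps.

(** * Supply of permutations and of real reflections *)

Lemma perm_pair n (i j k l : 'I_n) : i != j -> k != l ->
  exists s : {perm 'I_n}, s i = k /\ s j = l.
Proof.
(* The first transposition sends [i] to [k]; the second sends the image of [j] to [l] and fixes [k],
   which differs from both. *)
move=> ij kl; exists (tperm i k * tperm (tperm i k j) l)%g.
rewrite !permM tpermL tpermL [X in X = _ /\ _]tpermD // 1?(eq_sym l) //.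
by rewrite -(inj_eq (@perm_inj _ (tperm i k))) tpermK tpermR eq_sym.
Qed.

(** The reflection along [v] is symmetric, so orthogonality amounts to its square being the
    identity; there v^T v = s reduces the quartic term in [v] to a multiple of v v^T, which cancels
    the rest. *)
Lemma householder_orthogonal (R : realType) n (v : 'cV[R[i]]_n) (s : R[i]) :
  v \is a mxOver Num.real ->
  s \is Num.real -> v^T *m v = s%:M -> s != 0 ->
  let u : 'M[R[i]]_n := 1%:M - (2 / s) *: (v *m v^T) in
  u \is a mxOver Num.real /\ u *m u^T = 1%:M.
Proof.
move=> vR sR vv s0 u; split.
  apply/mxOverP => i j; rewrite !mxE big_ord1 !mxE.
  by rewrite rpredB ?realn // !rpredM ?rpredV ?realn ?(mxOverP vR).
have -> : u^T = u.
  by rewrite [u^T]linearB /= trmx1 [(_ *: _)^T]linearZ /= trmx_mul trmxK.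
rewrite /u mulmxBl mul1mx mulmxBr mulmx1 -scalemxAl -scalemxAr.
rewrite -mulmxA (mulmxA v^T) vv mul_scalar_mx -scalemxAr.
by apply/matrixP => i j; rewrite !mxE; field.
Qed.

(** * Linear maps commuting with conjugation by the orthogonal group *)

Section EquivariantMaps.
Variables (R : realType) (n : nat).
Local Notation C := R[i].
Local Notation M := 'M[C]_n.
Variable G : M -> M.
Hypotheses (G_lin : linear G) (G_act : acts_on (orthogonal_group R n) G).

Lemma equivariant_orthogonal (u : M) : u \is a mxOver Num.real ->
  u *m u^T = 1%:M -> forall x, G (u *m x *m u^T) = u *m G x *m u^T.
Proof. by move=> uR uO x; rewrite -trmxC_real // G_act. Qed.

Lemma equivariant_perm (s : {perm 'I_n}) i j k l :
  G (delta_mx (s i) (s j)) (s k) (s l) = G (delta_mx i j) k l.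
Proof.
pose u : M := perm_mx s.
have uE (x : M) k' l' : (u *m x *m u^T) k' l' = x (s k') (s l').
  by rewrite tr_perm_mx -col_permE -row_permE !mxE.
rewrite -uE -equivariant_orthogonal.
- congr (G _ k l); apply/matrixP => p q.
  by rewrite uE !mxE !(inj_eq perm_inj).
- by apply/mxOverP => p q; rewrite !mxE realn.
- by rewrite tr_perm_mx -perm_mxM fingroup.mulgV perm_mx1.
Qed.

(** Conjugation by the diagonal matrix that negates coordinate [p] multiplies entry (k, l) by a
    sign, and likewise scales E_ij; equivariance equates the two signs on each entry of the
    image. *)
Lemma equivariant_sign p i j k l :
  (-1) ^+ ((i == p) (+) (j == p)) * G (delta_mx i j) k l
  = (-1) ^+ ((k == p) (+) (l == p)) * G (delta_mx i j) k l.
Proof.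
pose u : M := diag_mx (\row_q (-1) ^+ (q == p)).
have uE (x : M) k' l' : (u *m x *m u^T) k' l' =
    (-1) ^+ ((k' == p) (+) (l' == p)) * x k' l'.
  by rewrite tr_diag_mx mul_diag_mx mul_mx_diag !mxE signr_addb mulrAC.
rewrite -uE -equivariant_orthogonal.
- have -> : u *m delta_mx i j *m u^T =
      (-1) ^+ ((i == p) (+) (j == p)) *: delta_mx i j.
    apply/matrixP => k' l'; rewrite uE !mxE.
    by case: (k' =P i) => [->|]; case: (l' =P j) => [->|]; rewrite ?mulr0.
  by rewrite (scalable_linear G_lin) mxE.
- apply: mxOver_diag; first exact: rpred0.
  by apply/mxOverP => ? q; rewrite !mxE rpredX // rpredN rpred1.
- rewrite tr_diag_mx mulmx_diag -[1%:M]diag_const_mx; congr diag_mx.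
  by apply/rowP => q; rewrite !mxE; case: (q == p); rewrite ?mulrNN mulr1.
Qed.

(** Unless [i], [j], [k], [l] split into two equal pairs, some index [p] occurs an odd number of
    times among them; [equivariant_sign] at that [p] makes the entry its own opposite. The case
    analysis finds such a [p]. *)
Lemma equivariant_delta0 i j k l :
  ~~ [|| (i == j) && (k == l), (k == i) && (l == j) | (k == j) && (l == i)] ->
  G (delta_mx i j) k l = 0.
Proof.
move=> H.
suff [p np] : exists p, ((i == p) (+) (j == p)) != ((k == p) (+) (l == p)).
  have := equivariant_sign p i j k l; move: np.
  have N (z : C) : z = - z -> z = 0.
    by move=> /eqP; rewrite -subr_eq0 opprK -mulr2n mulrn_eq0 => /eqP.
  by case: (_ (+) _); case: (_ (+) _) => //= _;
    rewrite ?(expr0, expr1, mulN1r, mul1r) => s; apply: N.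
case: (eqVneq i j) H => [->|ij] /=.
  rewrite !negb_or => /andP[kl _].
  by exists k; rewrite addbb eqxx (eq_sym l) (negPf kl).
case: (eqVneq k l) => [->|kl] /=.
  by move=> _; exists i; rewrite addbb eqxx (eq_sym j) (negPf ij).
case: (eqVneq k i) => [->|ki] /=.
  rewrite (negPf ij) orbF => lj.
  by exists j; rewrite (negPf ij) eqxx (negPf lj).
case: (eqVneq k j) => [->|kj] /= H.
  by exists i; rewrite eqxx (eq_sym j) (negPf ij) (negPf H).
by exists k; rewrite eqxx !(eq_sym i, eq_sym j, eq_sym l) (negPf ki)
  (negPf kj) (negPf kl).
Qed.

(** Signs and permutations leave four free constants [a], [b], [c], [d]; a reflection that is not a
    signed permutation then supplies the missing relation d = a + b + c. *)
Lemma equivariant_ttmap : (1 < n)%N -> exists p, G = ttmap C n p.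
Proof.
move=> n1.
pose o0 := Ordinal (ltnW n1); pose o1 := Ordinal n1.
have o01 : o0 != o1 by [].
(* One representative for each pattern of indices that survives [equivariant_delta0]; permutations
   carry it to all others of the same pattern. *)
pose a := G (delta_mx o0 o0) o1 o1.
pose b := G (delta_mx o0 o1) o0 o1.
pose c := G (delta_mx o0 o1) o1 o0.
pose d := G (delta_mx o0 o0) o0 o0.
have Ga i k : i != k -> G (delta_mx i i) k k = a.
  by move=> /(perm_pair _ o0 o1 _ _ o01) [s [<- <-]]; rewrite equivariant_perm.
have Gb i j : i != j -> G (delta_mx i j) i j = b.
  by move=> /(perm_pair _ o0 o1 _ _ o01) [s [<- <-]]; rewrite equivariant_perm.
have Gc i j : i != j -> G (delta_mx i j) j i = c.
  by move=> /(perm_pair _ o0 o1 _ _ o01) [s [<- <-]]; rewrite equivariant_perm.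
have Gd i : G (delta_mx i i) i i = d.
  by rewrite -(equivariant_perm (tperm i o0)) tpermL.
have Gii i : G (delta_mx i i) = a%:M + (d - a) *: delta_mx i i.
  apply/matrixP => k l; rewrite !mxE.
  case: (eqVneq k i) => [->|ki]; case: (eqVneq l i) => [->|li] /=.
  - by rewrite Gd ?eqxx; ring.
  - rewrite equivariant_delta0 ?mulr0n ?mulr0 ?addr0 //.
    by rewrite eqxx (eq_sym i l) (negPf li).
  - by rewrite equivariant_delta0 ?mulr0n ?mulr0 ?addr0 ?eqxx ?(negPf ki).
  - case: (eqVneq k l) => [<-|kl]; first by rewrite Ga 1?eq_sym //= mulr1n; ring.
    by rewrite equivariant_delta0 ?mulr0n ?mulr0 ?addr0 ?eqxx ?(negPf ki) ?(negPf kl).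
have Gij i j : i != j -> G (delta_mx i j) = b *: delta_mx i j + c *: delta_mx j i.
  move=> ij; apply/matrixP => k l; rewrite !mxE.
  case: (boolP ((k == i) && (l == j))) => [/andP[/eqP -> /eqP ->]|kl].
    by rewrite (negPf ij) Gb //=; ring.
  case: (boolP ((k == j) && (l == i))) => [/andP[/eqP -> /eqP ->]|kl'].
    by rewrite Gc //=; ring.
  by rewrite equivariant_delta0 ?(negPf ij) ?(negPf kl) ?(negPf kl') // !mulr0 addr0.
(* Both sides are the (0, 1) entry of the equivariance identity at E_00, up to common terms: u
   G(E_00) u^T gives the left one, G(u E_00 u^T) the right one. *)
have dE (u : M) x y : u \is a mxOver Num.real -> u *m u^T = 1%:M ->
    col o0 u = x *: delta_mx o0 0 + y *: delta_mx o1 0 ->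
    (d - a) * (x * y) = (b + c) * (x * y).
  move=> uR uO uc.
  have uE : u *m delta_mx o0 o0 *m u^T = (x * x) *: delta_mx o0 o0 +
      (x * y) *: (delta_mx o0 o1 + delta_mx o1 o0) + (y * y) *: delta_mx o1 o1.
    (* Factoring E_00 as a column times a row makes its conjugate the product of the first column of
       [u] with its transpose. *)
    rewrite -(mul_delta_mx (0 : 'I_1)) !mulmxA -mulmxA -colE.
    have -> : 'e_o0 *m u^T = (col o0 u)^T by rewrite tr_col rowE.
    rewrite uc [(_ + _)^T]linearD /= ![(_ *: _)^T]linearZ /= !trmx_delta.
    rewrite mulmxDl !mulmxDr -!scalemxAl -!scalemxAr !mul_delta_mx !scalerA.
    by rewrite (mulrC y x) scalerDr !addrA.
  have := equivariant_orthogonal u uR uO (delta_mx o0 o0).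
  have GD A B : G (A + B) = G A + G B.
    by have := G_lin 1 A B; rewrite !scale1r.
  rewrite uE !GD !(scalable_linear G_lin) GD.
  rewrite !Gii !Gij // mulmxDr mulmxDl mul_mx_scalar -scalemxAl uO.
  rewrite -scalemxAr -scalemxAl uE.
  move=> /matrixP /(_ o0 o1); rewrite !mxE /=.
  rewrite !(mulr0, mulr0n, mulr1, add0r, addr0, mulr1n).
  by move=> <-; ring.
have {}dE : d - a = b + c.
  (* The reflection along (1, 2) is rational: it sends e_0 to 3/5 e_0 - 4/5 e_1. *)
  pose v : 'cV[C]_n := delta_mx o0 0 + 2 *: delta_mx o1 0.
  have vT : v^T = delta_mx 0 o0 + 2 *: delta_mx 0 o1.
    by rewrite [v^T]linearD /= [(_ *: _)^T]linearZ /= !trmx_delta.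
  have vv : v^T *m v = 5%:M.
    rewrite vT mulmxDl !mulmxDr -!scalemxAl -!scalemxAr !mul_delta_mx.
    rewrite !mul_delta_mx_0 // !scaler0 addr0 add0r scalerA.
    by apply/matrixP => p q; rewrite !ord1 !mxE; ring.
  have vR : v \is a mxOver Num.real.
    by apply/mxOverP => p q; rewrite !mxE rpredD ?rpredM ?realn.
  have n50 : 5 != 0 :> C by rewrite pnatr_eq0.
  have [uR uO] := householder_orthogonal _ _ _ _ vR (realn _ 5) vv n50.
  have xy0 : 3 / 5 * - (4 / 5) != 0 :> C.
    by rewrite mulf_neq0 ?oppr_eq0 ?mulf_neq0 ?invr_eq0 ?pnatr_eq0.
  apply: (mulIf xy0); apply: dE uR uO _.
  (* This pairing makes the image of e_0 equal to e_0 - (2/5) v, whose two coordinates are the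
     required [x] and [y]. *)
  have ve : v^T *m delta_mx o0 0 = 1%:M.
    rewrite vT mulmxDl -scalemxAl mul_delta_mx mul_delta_mx_0 // scaler0 addr0.
    by apply/matrixP => p q; rewrite !ord1 !mxE.
  rewrite colE mulmxBl mul1mx -scalemxAl -mulmxA ve mulmx1.
  rewrite scalerDr opprD addrA -[X in X - _ - _]scale1r -scalerBl scalerA -scaleNr.
  by congr (_ *: _ + _ *: _); field.
exists (a, b, c); apply/funext.
apply: eq_linear_delta; [exact: G_lin|exact: ttmap_linear|move=> i j].
rewrite ttmap_delta /=; case: (eqVneq i j) => [<-|ij].
  by rewrite Gii dE mulr1n scalerDl addrA.
by rewrite Gij // mulr0n raddf0 add0r.
Qed.

End EquivariantMaps.

(** * The scalar system and its four solutions *)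

Section Classification.
Variables (R : realType) (n : nat).
Local Notation C := R[i].
Local Notation M := 'M[C]_n.

Definition graph_params : seq (C * C * C) :=
  [:: (0, 0, 0); (1, - n%:R^-1, 0); (2^-1, 0, - 2^-1); (2^-1, - n%:R^-1, 2^-1)].

Lemma ttmap_edgeless : ttmap C n (0, 0, 0) = edgeless_graph R n.
Proof. by apply/funext => x; rewrite /ttmap !scale0r !addr0. Qed.

Lemma ttmap_complete : ttmap C n (1, - n%:R^-1, 0) = complete_graph R n.
Proof.
by apply/funext => x; rewrite /ttmap /= scale1r scale0r addr0 scaleNr.
Qed.

Lemma ttmap_antisymmetric :
  ttmap C n (2^-1, 0, - 2^-1) = antisymmetric_graph R n.
Proof.
apply/funext => x.
by rewrite /ttmap /antisymmetric_graph /= scale0r addr0 scaleNr scalerBr.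
Qed.

Lemma ttmap_symmetric :
  ttmap C n (2^-1, - n%:R^-1, 2^-1) = symmetric_graph R n.
Proof.
apply/funext => x.
by rewrite /ttmap /symmetric_graph /= scalerDr scaleNr addrAC.
Qed.

(** The trace is invariant under conjugation, and since the adjoint of a real [u] is u^T,
    transposition commutes with conjugation by [u]. *)
Lemma ttmap_acts p : acts_on (orthogonal_group R n) (ttmap C n p).
Proof.
move=> u [uR uO] x; rewrite trmxC_real // /ttmap.
rewrite mxtrace_mulC mulmxA (mulmx1C uO) mul1mx !trmx_mul trmxK mulmxA.
rewrite !mulmxDr !mulmxDl -!scalemxAr -!scalemxAl.
by rewrite mul_mx_scalar -scalemxAl uO scalemx1.
Qed.

Lemma ttmap_real a b c : a \is Num.real -> b \is Num.real -> c \is Num.real ->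
  real_map (ttmap C n (a, b, c)).
Proof.
move=> /CrealP aR /CrealP bR /CrealP cR x.
rewrite /ttmap /= trace_map_mx mxtrace_tr.
apply/matrixP => i j; rewrite !mxE !rmorphD !rmorphM /= aR bR cR eq_sym.
by rewrite rmorphMn.
Qed.

Lemma ttmap_graphP p : (1 < n)%N ->
  [/\ quantum_graph (ttmap C n p), loopless (ttmap C n p)
    & acts_on (orthogonal_group R n) (ttmap C n p)] <-> p \in graph_params.
Proof.
move=> n1; have n0 : n%:R != 0 :> C by rewrite pnatr_eq0 -lt0n ltnW.
have two0 : 2 != 0 :> C by rewrite pnatr_eq0.
case: p => [[a b] c]; split=> [[[_ S _] L _]|].
  pose o0 := Ordinal (ltnW n1).
  (* Schur idempotency equates two maps of the same form on matrix units, hence everywhere;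
     injectivity then turns it into equations between coefficients. *)
  have /ttmap_inj : ttmap C n (a ^+ 2 + c ^+ 2,
    2 * a * b + n%:R * b ^+ 2 + 2 * b * c, 2 * a * c) = ttmap C n (a, b, c).
    apply/funext; apply: eq_linear_delta; try exact: ttmap_linear.
    by move=> i j; rewrite -ttmap_schur S.
  move=> /(_ n1)[aE _ cE].
  have abc : a + n%:R * b + c = 0.
    have := L o0 o0; rewrite ttmap_loop => /matrixP/(_ o0 o0).
    by rewrite !mxE !eqxx mulr1.
  (* Looplessness determines [b], so only [a] and [c] remain to be found. *)
  have bE : b = - (a + c) / n%:R.
    rewrite -[LHS](mulKf n0) mulrC; congr (_ / _).
    by rewrite -[LHS]subr0 -abc; ring.
  have /eqP : c * (a - 2^-1) = 0.
    have -> : c * (a - 2^-1) = (2 * a * c - c) / 2 by field.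
    by rewrite cE subrr mul0r.
  (* If c = 0, the first equation becomes a^2 = a, giving the edgeless and complete graphs; if a =
     1/2, it becomes c^2 = 1/4, giving the symmetric and antisymmetric ones. *)
  rewrite mulf_eq0 subr_eq0 => /orP[]/eqP ac; move: aE bE; rewrite {}ac.
    move=> aE; have /eqP : a * (a - 1) = 0.
      by rewrite -[RHS](subrr a) -{3}aE; ring.
    rewrite mulf_eq0 subr_eq0 => /orP[]/eqP -> ->; rewrite !inE.
      by rewrite addr0 oppr0 mul0r eqxx.
    by rewrite addr0 mulN1r eqxx ?orbT.
  move=> aE; have /eqP : (c - 2^-1) * (c + 2^-1) = 0.
    have -> : (c - 2^-1) * (c + 2^-1) = (2^-1) ^+ 2 + c ^+ 2 - 2^-1 by field.
    by rewrite aE subrr.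
  rewrite mulf_eq0 subr_eq0 addr_eq0 => /orP[]/eqP -> ->; rewrite !inE.
    have -> : 2^-1 + 2^-1 = 1 :> C by field.
    by rewrite mulN1r eqxx ?orbT.
  by rewrite subrr oppr0 mul0r eqxx ?orbT.
move=> pP.
have eqs : [/\ a ^+ 2 + c ^+ 2 = a,
    2 * a * b + n%:R * b ^+ 2 + 2 * b * c = b, 2 * a * c = c &
    a + n%:R * b + c = 0].
  by move: pP; rewrite !inE => /or4P[]/eqP[-> -> ->]; split; field.
have [aR bR cR] : [/\ a \is Num.real, b \is Num.real & c \is Num.real].
  by move: pP; rewrite !inE => /or4P[]/eqP[-> -> ->]; split;
     rewrite ?rpredN ?rpredV ?rpred0 ?rpred1 ?realn.
case: eqs => aE bE cE lE; split; last exact: ttmap_acts.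
- split; [exact: ttmap_linear| |exact: ttmap_real].
  by move=> i j; rewrite ttmap_schur aE bE cE.
- by move=> i j; rewrite ttmap_loop lE scale0r.
Qed.

End Classification.
Arguments graph_params : clear implicits.

(** * Assembly of the classification and pairwise distinctness of the four graphs *)

Theorem proposition3p7 (R : realType) (n : nat) (hn : (2 <= n)%N) :
  let four : set ('M[R[i]]_n -> 'M[R[i]]_n) :=
    [set edgeless_graph R n; complete_graph R n;
         antisymmetric_graph R n; symmetric_graph R n] in
  [set G : 'M[R[i]]_n -> 'M[R[i]]_n |
     [/\ quantum_graph G, loopless G & acts_on (orthogonal_group R n) G]]
    = four
  /\ four #= `I_4.
Proof.
move=> four.
have fourE : four = [set ttmap R[i] n p | p in [set` graph_params R n]].
  rewrite /four -ttmap_edgeless -ttmap_complete -ttmap_antisymmetric -ttmap_symmetric.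
  apply/seteqP; split=> [G [[[]|]|] -> | G [p]].
  - by exists (0, 0, 0); rewrite //= !inE eqxx.
  - by exists (1, - n%:R^-1, 0); rewrite //= !inE eqxx ?orbT.
  - by exists (2^-1, 0, - 2^-1); rewrite //= !inE eqxx ?orbT.
  - by exists (2^-1, - n%:R^-1, 2^-1); rewrite //= !inE eqxx ?orbT.
  by rewrite /= !inE => /or4P[] /eqP -> <-;
    [left; left; left|left; left; right|left; right|right].
split.
  rewrite fourE; apply/seteqP; split=> [G GP | _ [p pP <-]].
    have [[lG _ _] _ aG] := GP.
    have [p Gp] := equivariant_ttmap _ _ _ lG aG hn.
    by exists p => //=; apply/(ttmap_graphP _ _ _ hn); rewrite -Gp.
  by apply/ttmap_graphP.
(* The first coefficients 0, 1 and 1/2 separate all triples but the last two, which differ in the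
   sign of the third. *)
have uniq_params : uniq (graph_params R n).
  have h0 : 2^-1 != 0 :> R[i] by rewrite invr_eq0 pnatr_eq0.
  have h1 : 1 != 2^-1 :> R[i] by rewrite eq_sym invr_eq1 pnatr_eq1.
  have hN : - 2^-1 != 2^-1 :> R[i].
    by rewrite -subr_eq0 -opprD oppr_eq0 -mulr2n mulrn_eq0.
  rewrite /= !inE !xpair_eqE !(eq_sym 0).
  by rewrite (negPf h0) (negPf h1) (negPf hN) oner_eq0 !andbF.
(* The enumeration is used only for k < 4, where the default triple is never reached; it is
   injective there because the triples are distinct and n is at least 2. *)
pose f k := ttmap R[i] n (nth (0, 0, 0) (graph_params R n) k).
have -> : four = f @` `I_4.
  rewrite fourE; apply/seteqP; split=> [_ [p /= pP <-] | _ [k k4 <-]].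
    exists (index p (graph_params R n)); last by rewrite /f nth_index.
    by move: pP; rewrite -index_mem.
  by exists (nth (0, 0, 0) (graph_params R n) k) => //=; apply: mem_nth.
apply: inj_card_eq => j k; rewrite !inE => j4 k4 /(ttmap_inj _ _ hn) /eqP.
by rewrite nth_uniq // => /eqP.
Qed.
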